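(* Let $a,b,c$ be positive integers such that $H=\langle a,b,c\rangle$ is a numerical semigroup that is not symmetric. Let $k$ be a field, and suppose that $\alpha,\beta,\gamma,\alpha',\beta',\gamma'$ are positive integers such that the kernel of the $k$-algebra homomorphism $\varphi:k[X,Y,Z]\to k[t]$, $\varphi(X)=t^a$, $\varphi(Y)=t^b$, $\varphi(Z)=t^c$, is the ideal generated by the maximal minors of the matrix $$\begin{pmatrix} X^{\alpha} & Y^{\beta} & Z^{\gamma}\\ Y^{\beta'} & Z^{\gamma'} & X^{\alpha'}\end{pmatrix}.$$ Then $H$ is pseudo-symmetric if and only if both of the following hold: (1) if $\beta' b>\alpha a$, then $\alpha=\beta=\gamma=1$; and (2) if $\beta' b<\alpha a$, then $\alpha'=\beta'=\gamma'=1$.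
   Context: $\mathbb{N}$ is the set of nonnegative integers. A numerical semigroup $H$ is a subset of $\mathbb{N}$ containing $0$, closed under addition, with $\mathbb{N}\setminus H$ finite; $\langle a_1,\dots,a_n\rangle=\sum_{i=1}^n a_i\mathbb{N}$. The Frobenius number is $\mathrm{F}(H)=\max\{n\in\mathbb{Z}\mid n\notin H\}$ and the genus is $\mathrm{g}(H)=\mathrm{Card}(\mathbb{N}\setminus H)$. $H$ is symmetric if $\mathrm{F}(H)$ is odd and for every $x\in\mathbb{Z}$ either $x\in H$ or $\mathrm{F}(H)-x\in H$ (equivalently $2\mathrm{g}(H)=\mathrm{F}(H)+1$). $H$ is pseudo-symmetric if $\mathrm{F}(H)$ is even and for every $x\in\mathbb{Z}$ with $x\neq \mathrm{F}(H)/2$ either $x\in H$ or $\mathrm{F}(H)-x\in H$ (equivalently $2\mathrm{g}(H)=\mathrm{F}(H)+2$). For every non-symmetric $H=\langle a,b,c\rangle$ it is known (Herzog) that the kernel of $\varphi$ is generated by the maximal minors of a matrix of the stated form for some positive integers $\alpha,\beta,\gamma,\alpha',\beta',\gamma'$. *)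

(* Defs.v *)
From HB Require Import structures.
From mathcomp Require Import all_boot all_order all_algebra.
From mathcomp Require Import mpoly.

Set Implicit Arguments.
Unset Strict Implicit.
Unset Printing Implicit Defensive.

Import GRing.Theory Num.Theory.
Local Open Scope ring_scope.

Definition numerical_semigroup (H : nat -> Prop) : Prop :=
  [/\ H 0%N,
      forall x y : nat, H x -> H y -> H (x + y)%N
    & exists gaps : seq nat, forall x : nat, ~ H x -> x \in gaps].

Definition gen_semigroup (s : seq nat) (x : nat) : Prop :=
  exists m : 'I_(size s) -> nat, x = (\sum_i m i * nth 0 s i)%N.

Definition memZ (H : nat -> Prop) (z : int) : Prop :=
  exists2 n : nat, z = n%:Z & H n.

(* The maximum is taken in Z, so that F(N) = -1. It exists and is unique for a
   numerical semigroup, hence the relational form. *)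
Definition is_frobenius (H : nat -> Prop) (f : int) : Prop :=
  ~ memZ H f /\ forall z : int, ~ memZ H z -> z <= f.

Definition symmetric_semigroup (H : nat -> Prop) : Prop :=
  exists f : int,
    [/\ is_frobenius H f,
        ~~ (2%:Z %| f)%Z
      & forall x : int, memZ H x \/ memZ H (f - x)].

Definition pseudo_symmetric_semigroup (H : nat -> Prop) : Prop :=
  exists f : int,
    [/\ is_frobenius H f,
        (2%:Z %| f)%Z
      & forall x : int, x <> (f %/ 2%:Z)%Z -> memZ H x \/ memZ H (f - x)].

Definition ideal_gen (R : comPzRingType) (S : R -> Prop) (x : R) : Prop :=
  exists (n : nat) (r g : 'I_n -> R),
    (forall i, S (g i)) /\ x = \sum_i r i * g i.

Definition maximal_minor (R : comPzRingType) (m n : nat) (A : 'M[R]_(m, n))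
    (x : R) : Prop :=
  exists f : 'I_m -> 'I_n,
    (forall i j : 'I_m, (i < j)%N -> (f i < f j)%N) /\ x = \det (colsub f A).

Section MonomialCurve.
Variable k : fieldType.

Definition varX : {mpoly k[3]} := 'X_(inord 0).
Definition varY : {mpoly k[3]} := 'X_(inord 1).
Definition varZ : {mpoly k[3]} := 'X_(inord 2).

Definition curve_morphism (a b c : nat) : {mpoly k[3]} -> {poly k} :=
  mmap (@polyC k) (fun i : 'I_3 => 'X^(nth 0%N [:: a; b; c] i)).

Definition herzog_matrix (al be ga al' be' ga' : nat) : 'M[{mpoly k[3]}]_(2, 3) :=
  \matrix_(i < 2, j < 3)
    nth 0 (nth [::] [:: [:: varX ^+ al; varY ^+ be; varZ ^+ ga];
                        [:: varY ^+ be'; varZ ^+ ga'; varX ^+ al']] i) j.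

End MonomialCurve.

(* Main.v *)
Require Import Defs.
From mathcomp Require Import all_boot all_order all_algebra.
From mathcomp Require Import mpoly.
From mathcomp Require Import zify.
From Stdlib Require Import Classical_Prop.

Set Implicit Arguments.
Unset Strict Implicit.
Unset Printing Implicit Defensive.

Import Order.TTheory GRing.Theory Num.Theory.

(** Write A = al + al', B = be + be', C = ga + ga'. The three minors are the
    binomials X^al Z^ga' - Y^B, X^A - Y^be' Z^ga and X^al' Y^be - Z^C, so the
    hypothesis on the kernel says two things. The minors lie in the kernel, which
    gives three relations between a, b and c. Conversely, the kernel is no larger
    than the ideal I of the minors: modulo Z this ideal becomes the monomial ideal
    (X^A, Y^B, X^al' Y^be), so no element of I involves a monomial X^i Y^j whose
    exponent (i, j) lies in the staircase under these three monomials
    ([mcoeff_ideal_staircase]). Since X^i Y^j - X^p Y^q Z^r is in the kernel as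
    soon as both monomials have the same degree, i a + j b has no other
    expression as a combination of a, b and c. This is all that is kept of the
    algebra ([herzog_dataP]).

    What remains is arithmetic. The values i a + j b on the staircase form the
    Apery set of H with respect to c: using the three relations to trade powers
    of X and Y for powers of Z, every integer is i a + j b + r c with (i, j) in
    the staircase and r in Z, and it belongs to H exactly when r >= 0
    ([staircase_normal_form], [memZ_staircase]). The staircase is a union of two
    rectangles, with outer corners (A - 1, be - 1) and (al' - 1, B - 1); the
    corresponding Apery elements minus c are the pseudo-Frobenius numbers f1 and
    f2 of H. Their difference is f2 - f1 = be' b - al a, so if al a < be' b then
    F(H) = f2. Neither f1 nor f2 - f1 is in H, hence pseudo-symmetry forces
    2 f1 = f2; conversely, if 2 f1 = f2 the reflection x |-> f2 - x is read off
    normal forms. Finally 2 f1 - f2 = (al a + be b + ga c) - (a + b + c), which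
    vanishes exactly when al = be = ga = 1 ([pseudo_symmetric_upper]).

    The case al a > be' b follows by exchanging the two rows of the matrix
    together with the roles of X and Y ([herzog_data_swap]), and al a = be' b is
    impossible because f1 and f2 differ by a number outside H
    ([exponents_neq]). *)

(** * The staircase and its arithmetic *)

(** The exponents (i, j) of the monomials X^i Y^j outside the ideal
    (X^(al + al'), Y^(be + be'), X^al' Y^be), as a union of two rectangles. *)
Definition staircase (al be al' be' i j : nat) : bool :=
  (i < al + al') && (j < be) || (i < al') && (j < be + be').

(** The numerical content of Herzog's description of the kernel: the degrees of the
    two terms of each minor agree, and the monomials of the staircase are alone
    in their degree. *)
Record herzog_data (a b c al be ga al' be' ga' : nat) : Prop := HerzogData {
  generators_gt0 : [/\ 0 < a, 0 < b & 0 < c];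
  upper_gt0 : [/\ 0 < al, 0 < be & 0 < ga];
  lower_gt0 : [/\ 0 < al', 0 < be' & 0 < ga'];
  relY : al * a + ga' * c = (be + be') * b;
  relX : (al + al') * a = be' * b + ga * c;
  relZ : be * b + al' * a = (ga + ga') * c;
  staircase_unique : forall i j p q r : nat, staircase al be al' be' i j ->
    i * a + j * b = p * a + q * b + r * c -> [/\ p = i, q = j & r = 0] }.

Section HerzogArithmetic.
Context (a b c al be ga al' be' ga' : nat).
Hypothesis D : herzog_data a b c al be ga al' be' ga'.

(** Exchanging X with Y and the rows of the matrix permutes its columns into the
    same shape, and reflects the staircase in the diagonal. *)
Lemma herzog_data_swap : herzog_data b a c be' al' ga' be al ga.
Proof.
have [? ? ?] := generators_gt0 D; have [? ? ?] := upper_gt0 D.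
have [? ? ?] := lower_gt0 D.
have := relX D; have := relY D; have := relZ D => rZ rY rX.
split; [by []|by []|by []|lia|lia|lia|].
move=> i j p q r ij e.
have ji : staircase al be al' be' j i by move: ij; rewrite /staircase; lia.
by have [| -> -> ->] := staircase_unique (p := q) (q := p) (r := r) D ji; first by lia.
Qed.

(** Outside the staircase one of the three relations applies. It turns some X's
    and Y's into Z's (and others into each other), and the part i a + j b carried
    by X and Y strictly decreases because Z's have positive degree. *)
Lemma staircase_reduction i j : exists i' j' r : nat,
  staircase al be al' be' i' j' /\ i * a + j * b = i' * a + j' * b + r * c.
Proof.
have [a0 b0 c0] := generators_gt0 D; have [al0 be0 ga0] := upper_gt0 D.
have [al0' be0' ga0'] := lower_gt0 D.
have rX := relX D; have rY := relY D; have rZ := relZ D.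
have pgac : 0 < ga * c by rewrite muln_gt0 ga0.
have pgac' : 0 < ga' * c by rewrite muln_gt0 ga0'.
have [n] := ubnP (i * a + j * b); elim: n i j => // n IHn i j lt_n.
have [ij|] := boolP (staircase al be al' be' i j).
  by exists i, j, 0; split => //; lia.
move=> nij; have {nij} : [\/ al + al' <= i, be + be' <= j | (al' <= i) && (be <= j)].
  move: nij; rewrite /staircase; case: (leqP (al + al') i) => Hi; first by constructor 1.
  by case: (leqP (be + be') j) => Hj; [constructor 2 | constructor 3; lia].
case.
- move/subnK; set i1 := i - _ => Ei; rewrite -Ei in lt_n *.
  have [|i' [j' [r [ij' e]]]] := IHn i1 (j + be'); first by lia.
  by exists i', j', (r + ga); split => //; lia.
- move/subnK; set j1 := j - _ => Ej; rewrite -Ej in lt_n *.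
  have [|i' [j' [r [ij' e]]]] := IHn (i + al) j1; first by lia.
  by exists i', j', (r + ga'); split => //; lia.
- case/andP => /subnK; set i1 := i - _ => Ei /subnK; set j1 := j - _ => Ej.
  rewrite -Ei -Ej in lt_n *.
  have [|i' [j' [r [ij' e]]]] := IHn i1 j1; first by lia.
  by exists i', j', (r + (ga + ga')); split => //; lia.
Qed.

Variable H : nat -> Prop.
Hypothesis HE : forall x, H x <-> exists p q r : nat, x = p * a + q * b + r * c.
Hypothesis numH : numerical_semigroup H.

(** If r < 0 and the integer were in H, adding -r copies of c would express
    i a + j b with a positive coefficient of c, against uniqueness. *)
Lemma memZ_staircase i j (r : int) : staircase al be al' be' i j ->
  memZ H ((i * a + j * b)%N%:Z + r * c%:Z)%R <-> (0 <= r)%R.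
Proof.
move=> ij; split; last first.
  case: r => // r _; exists (i * a + j * b + r * c); first by lia.
  by apply/HE; exists i, j, r.
case: r => // r [n e /HE [p [q [s En]]]].
have := staircase_unique (p := p) (q := q) (r := s + r.+1) D ij.
by case; lia.
Qed.

(** Since H is cofinite, x + N c lies in H for large N; reduce that element to the
    staircase and subtract N from the coefficient of c. *)
Lemma staircase_normal_form (x : int) : exists i j (r : int),
  staircase al be al' be' i j /\ x = ((i * a + j * b)%N%:Z + r * c%:Z)%R.
Proof.
have [_ _ c0] := generators_gt0 D; have [_ _ [gaps gapsP]] := numH.
pose N := `|x|%N + (\max_(g <- gaps) g).+1.
have [n En] : exists n : nat, (x + (N * c)%N%:Z = n%:Z)%R.
  exists (absz (x + (N * c)%N%:Z)%R); have : N <= N * c by rewrite leq_pmulr.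
  by rewrite /N; lia.
have [p [q [s Ens]]] : exists p q r : nat, n = p * a + q * b + r * c.
  apply/HE; apply: NNPP => nHn; have n_gap := gapsP _ nHn.
  have := @leq_bigmax_seq _ gaps xpredT id n n_gap isT; have : N <= N * c by rewrite leq_pmulr.
  by move: En; rewrite /N /=; lia.
have [i [j [r [ij e]]]] := staircase_reduction p q.
exists i, j, ((r + s)%N%:Z - N%:Z)%R; split => //; lia.
Qed.

(** The two pseudo-Frobenius numbers of H: the Apery elements with respect to c at
    the outer corners of the staircase, minus c. *)
Definition corner1 : int :=
  (((al + al').-1 * a + be.-1 * b)%N%:Z - c%:Z)%R.
Definition corner2 : int :=
  ((al'.-1 * a + (be + be').-1 * b)%N%:Z - c%:Z)%R.

Lemma corner1_notin : ~ memZ H corner1.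
Proof.
have [? ? ?] := upper_gt0 D; have [? ? ?] := lower_gt0 D.
have ij : staircase al be al' be' (al + al').-1 be.-1 by rewrite /staircase; lia.
by have [h _] := memZ_staircase (-1) ij; rewrite mulN1r in h => /h.
Qed.

Lemma corner2_notin : ~ memZ H corner2.
Proof.
have [? ? ?] := upper_gt0 D; have [? ? ?] := lower_gt0 D.
have ij : staircase al be al' be' al'.-1 (be + be').-1 by rewrite /staircase; lia.
by have [h _] := memZ_staircase (-1) ij; rewrite mulN1r in h => /h.
Qed.

Lemma corner_diff : (corner2 - corner1 = (be' * b)%N%:Z - (al * a)%N%:Z)%R.
Proof.
have [? ? ?] := upper_gt0 D; have [? ? ?] := lower_gt0 D.
rewrite /corner1 /corner2.
have -> : (al + al').-1 = al'.-1 + al by lia.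
have -> : (be + be').-1 = be.-1 + be' by lia.
lia.
Qed.

(** Writing the difference as p a + q b + r c would give be' b, which is on the
    staircase, a second expression with at least al > 0 copies of a. *)
Lemma corner_diff_notin : ~ memZ H (corner2 - corner1)%R.
Proof.
have [? ? ?] := upper_gt0 D; have [? ? ?] := lower_gt0 D.
rewrite corner_diff => -[n e /HE [p [q [r En]]]].
have ij : staircase al be al' be' 0 be' by rewrite /staircase; lia.
have := staircase_unique (p := al + p) (q := q) (r := r) D ij.
by case; lia.
Qed.

Lemma exponents_neq : al * a <> be' * b.
Proof.
move=> e; apply: corner_diff_notin; rewrite corner_diff e subrr.
by exists 0 => //; apply/HE; exists 0, 0, 0.
Qed.

(** Integers outside H have r <= -1 in their normal form, and the staircase lies
    below its two corners, of which the second is the larger here. *)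
Lemma corner2_frobenius : al * a < be' * b -> is_frobenius H corner2.
Proof.
move=> lt_ab; split; first exact: corner2_notin.
move=> z; have [i [j [r [ij ->]]]] := staircase_normal_form z.
move=> zH; have {zH} r_lt0 : (r <= -1)%R.
  have [//|r_ge0] := leP r (-1)%R; case: zH.
  by apply/(memZ_staircase _ ij); lia.
have rc : (r * c%:Z <= - c%:Z)%R by rewrite -mulN1r ler_wpM2r.
have := corner_diff; rewrite /corner1 /corner2 => d.
have [/andP[Hi Hj]|/andP[Hi Hj]] := orP ij.
  have := leq_mul (_ : i <= (al + al').-1) (leqnn a).
  have := leq_mul (_ : j <= be.-1) (leqnn b); lia.
have := leq_mul (_ : i <= al'.-1) (leqnn a).
have := leq_mul (_ : j <= (be + be').-1) (leqnn b); lia.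
Qed.

Lemma double_corner :
  (corner1 *+ 2 = corner2 + (al * a + be * b + ga * c)%N%:Z - (a + b + c)%N%:Z)%R.
Proof.
have [? ? ?] := upper_gt0 D; have [? ? ?] := lower_gt0 D.
have := relX D; rewrite /corner1 /corner2.
have [al1 ->] : exists n, al' = n.+1 by exists al'.-1; lia.
have [be1 ->] : exists n, be = n.+1 by exists be.-1; lia.
rewrite addnS addSn /=; lia.
Qed.

Lemma double_cornerE :
  (corner1 *+ 2 = corner2)%R <-> [/\ al = 1, be = 1 & ga = 1].
Proof.
have [? ? ?] := generators_gt0 D; have [? ? ?] := upper_gt0 D.
have d2 := double_corner; split => [e|[E1 E2 E3]]; last first.
  by move: d2; rewrite E1 E2 E3; lia.
have E : al * a + be * b + ga * c = a + b + c by lia.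
have [al1 Ea] : exists n, al = n.+1 by exists al.-1; lia.
have [be1 Eb] : exists n, be = n.+1 by exists be.-1; lia.
have [ga1 Ec] : exists n, ga = n.+1 by exists ga.-1; lia.
have : al1 * a + be1 * b + ga1 * c = 0 by move: E; rewrite Ea Eb Ec; lia.
by move/eqP; rewrite !addn_eq0 !muln_eq0; split; lia.
Qed.

(** As neither corner1 nor its reflection F(H) - corner1 is in H, corner1 is the only
    possible exceptional point of the symmetry, that is F(H) / 2. Conversely,
    when al = be = ga = 1 the staircase is the rectangle i < al', j <= be' plus
    the single point (al', 0). The reflection x |-> F(H) - x turns the rectangle
    around and fixes the extra point, sending r to -1 - r on the former and to
    -2 - r on the latter; only r = -1 at the extra point, which is corner1, is
    not moved between r < 0 and r >= 0. *)
Lemma pseudo_symmetric_upper : al * a < be' * b ->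
  pseudo_symmetric_semigroup H <-> [/\ al = 1, be = 1 & ga = 1].
Proof.
move=> lt_ab; have [F_out F_max] := corner2_frobenius lt_ab.
split=> [[f [[f_out f_max] f_even f_sym]] | ones].
  have Ef : f = corner2.
    by apply/eqP; rewrite eq_le F_max // f_max.
  apply/double_cornerE; subst f.
  (* corner2 is even, so corner2 %/ 2 doubles back to it *)
  have [half|nhalf] := eqVneq corner1 (corner2 %/ 2%:Z)%Z; first by lia.
  by have [/corner1_notin | /corner_diff_notin] := f_sym _ (elimN eqP nhalf).
have e2 : (corner1 *+ 2 = corner2)%R by apply/double_cornerE.
exists corner2; split => //; first by lia.
move=> x; have [i [j [r [ij ->]]]] := staircase_normal_form x.
have [-> //= | neq1] := eqVneq ((i * a + j * b)%N%:Z + r * c%:Z)%R corner1.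
  by case; lia.
move=> _; have [r0|r0] := leP 0%R r; first by left; apply/(memZ_staircase _ ij).
right; case: ones => E1 E2 E3; have [? ? ?] := lower_gt0 D.
have [lt_i|ge_i] := ltnP i al'.
  have kl : staircase al be al' be' (al'.-1 - i) ((be + be').-1 - j).
    by rewrite /staircase E2; lia.
  have -> : (corner2 - ((i * a + j * b)%N%:Z + r * c%:Z) =
      ((al'.-1 - i) * a + ((be + be').-1 - j) * b)%N%:Z + (-1 - r) * c%:Z)%R.
    rewrite /corner2.
    have [k Ek] : exists k, al'.-1 = k + i by exists (al'.-1 - i); lia.
    have [l El] : exists l, (be + be').-1 = l + j.
      by exists ((be + be').-1 - j); move: ij; rewrite /staircase; lia.
    rewrite Ek El !addnK; lia.
  by apply/(memZ_staircase _ kl); lia.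
have [Ei Ej] : i = al' /\ j = 0 by move: ij; rewrite /staircase; lia.
subst i j; rewrite -e2 /corner1 E1 E2 /= in neq1 *.
have r1 : (r != -1)%R.
  by apply: contraNneq neq1 => ->; apply/eqP; lia.
have -> : (((al' * a + 0 * b)%N%:Z - c%:Z) *+ 2 - ((al' * a + 0 * b)%N%:Z + r * c%:Z)
   = ((al' * a + 0 * b)%N%:Z + (-2 - r) * c%:Z) :> int)%R by lia.
by apply/(memZ_staircase _ ij); lia.
Qed.

End HerzogArithmetic.

(** * From the ideal to the arithmetic *)

Local Open Scope ring_scope.

Definition monomial3 (i j r : nat) : 'X_{1..3} :=
  [multinom nth 0%N [:: i; j; r] t | t < 3].

Lemma monomial3_inj i j r p q s :
  monomial3 i j r = monomial3 p q s -> [/\ i = p, j = q & r = s].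
Proof.
move=> /mnmP e; have := (e (inord 0), e (inord 1), e (inord 2)).
by rewrite !mnmE !inordK //= => -[[-> ->] ->].
Qed.

Lemma lem_monomial3 i j r p q s :
  (monomial3 i j r <= monomial3 p q s)%MM = [&& (i <= p)%N, (j <= q)%N & (r <= s)%N].
Proof.
apply/mnm_lepP/and3P => [e | [e0 e1 e2] [[|[|[|//]]] lt_t]]; last 3 first.
- by rewrite !mnmE.
- by rewrite !mnmE.
- by rewrite !mnmE.
by have := (e (inord 0), e (inord 1), e (inord 2)); rewrite !mnmE !inordK //= => -[[]].
Qed.

Lemma mul_monomial3 (R : nzRingType) i j r p q s :
  'X_[monomial3 i j r] * 'X_[monomial3 p q s] =
  'X_[monomial3 (i + p) (j + q) (r + s)] :> {mpoly R[3]}.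
Proof.
rewrite -mpolyXD; congr mpolyX; apply/mnmP => -[[|[|[|//]]] lt_t];
by rewrite !mnmE.
Qed.

Lemma monomialE (k : fieldType) n :
  [/\ varX k ^+ n = 'X_[monomial3 n 0 0], varY k ^+ n = 'X_[monomial3 0 n 0]
    & varZ k ^+ n = 'X_[monomial3 0 0 n]].
Proof.
split; rewrite mpolyXn; congr mpolyX; apply/mnmP => -[[|[|[|//]]] lt_t];
by rewrite mulmnE mnm1E mnmE -val_eqE /= inordK // ?mul1n ?mul0n.
Qed.

Lemma curve_morphismB (k : fieldType) a b c (p q : {mpoly k[3]}) :
  curve_morphism a b c (p - q) = curve_morphism a b c p - curve_morphism a b c q.
Proof. exact: mmapB. Qed.

Lemma curve_morphism_monomial (k : fieldType) a b c i j r :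
  curve_morphism a b c ('X_[monomial3 i j r] : {mpoly k[3]}) =
  'X^(i * a + j * b + r * c).
Proof.
rewrite /curve_morphism mmapX /mmap1 !big_ord_recl big_ord0 !mnmE /=.
by rewrite mulr1 -!exprM -!exprD !(mulnC _ a, mulnC _ b, mulnC _ c) addnA.
Qed.

(** Equality of degrees is detected on t-monomials through their sizes as
    polynomials. *)
Lemma curve_morphism_binomial (k : fieldType) a b c i j r p q s :
  curve_morphism a b c
    ('X_[monomial3 i j r] - 'X_[monomial3 p q s] : {mpoly k[3]}) = 0 <->
  (i * a + j * b + r * c = p * a + q * b + s * c)%N.
Proof.
rewrite curve_morphismB !curve_morphism_monomial; split => [e|->]; last first.
  by rewrite subrr.
have := congr1 (fun u : {poly k} => size u) (subr0_eq e).
by rewrite !size_polyXn => -[].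
Qed.

Lemma det2 (R : comPzRingType) (A : 'M[R]_2) :
  \det A = A 0 0 * A 1 1 - A 0 1 * A 1 0.
Proof.
rewrite (expand_det_row _ 0) !big_ord_recl big_ord0 addr0 /cofactor !det_mx11 !mxE.
rewrite /= expr0 expr1 mul1r mulN1r mulrN.
by do 4 f_equal; apply/val_inj.
Qed.

Lemma maximal_minor_herzog (k : fieldType) al be ga al' be' ga' p :
  maximal_minor (herzog_matrix k al be ga al' be' ga') p <->
  [\/ p = 'X_[monomial3 al 0 ga'] - 'X_[monomial3 0 (be + be') 0],
      p = 'X_[monomial3 (al + al') 0 0] - 'X_[monomial3 0 be' ga]
    | p = 'X_[monomial3 al' be 0] - 'X_[monomial3 0 0 (ga + ga')]].
Proof.
have XE n : varX k ^+ n = 'X_[monomial3 n 0 0] by case: (monomialE k n).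
have YE n : varY k ^+ n = 'X_[monomial3 0 n 0] by case: (monomialE k n).
have ZE n : varZ k ^+ n = 'X_[monomial3 0 0 n] by case: (monomialE k n).
have minorE (f : 'I_2 -> 'I_3) :
    \det (colsub f (herzog_matrix k al be ga al' be' ga')) =
    [:: varX k ^+ al; varY k ^+ be; varZ k ^+ ga]`_(f 0) *
    [:: varY k ^+ be'; varZ k ^+ ga'; varX k ^+ al']`_(f 1) -
    [:: varX k ^+ al; varY k ^+ be; varZ k ^+ ga]`_(f 1) *
    [:: varY k ^+ be'; varZ k ^+ ga'; varX k ^+ al']`_(f 0).
  by rewrite det2 !mxE.
split=> [[f [f_incr ->]] | pE].
  have lt01 : (f 0%R < f 1%R)%N by apply: f_incr.
  rewrite minorE; case: (f 0) (f 1) lt01 => [u lt_u] [v lt_v] /= lt_uv.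
  have [] : [\/ u = 0 /\ v = 1, u = 0 /\ v = 2 | u = 1 /\ v = 2]%N.
  - case: u v lt_u lt_v lt_uv => [|[|u]] [|[|[|v]]] //= *;
      by [constructor 1 | constructor 2 | constructor 3].
  - case=> -> ->; constructor 1.
    by rewrite /= !XE !YE !ZE !mul_monomial3 !addn0.
  - case=> -> ->; constructor 2.
    by rewrite /= !XE !YE !ZE !mul_monomial3 !addn0.
  - case=> -> ->; constructor 3.
    by rewrite /= !XE !YE !ZE !mul_monomial3 !addn0.
pose cols (u v : 'I_3) (t : 'I_2) := if t == 0 then u else v.
have minor_cols (u v : 'I_3) : (u < v)%N ->
    p = \det (colsub (cols u v) (herzog_matrix k al be ga al' be' ga')) ->
    maximal_minor (herzog_matrix k al be ga al' be' ga') p.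
  move=> lt_uv pE'; exists (cols u v); split=> // -[[|[|//]] ?] [[|[|//]] ?] //.
case: pE => pE; [apply: (minor_cols 0 1) | apply: (minor_cols 0 (inord 2))
  | apply: (minor_cols 1 (inord 2))]; rewrite ?inordK // minorE /cols /= ?inordK //=;
  by rewrite !XE !YE !ZE !mul_monomial3 !addn0.
Qed.

Lemma mcoeffMX_notin n (R : nzRingType) (p : {mpoly R[n]}) (u m : 'X_{1..n}) :
  ~~ (u <= m)%MM -> (p * 'X_[u])@_m = 0.
Proof.
move=> not_le; rewrite mcoeffM big1 // => -[v w] /= /eqP Em.
rewrite mcoeffX; case: eqVneq => [Eu|_]; last by rewrite mulr0.
by case/negP: not_le; rewrite Em Eu lem_addl.
Qed.

(** Each term of a minor is either divisible by Z or one of the three monomials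
    that bound the staircase: none of them divides a staircase monomial, so no
    multiple of a minor involves one. *)
Lemma mcoeff_ideal_staircase (k : fieldType) al be ga al' be' ga' i j p :
    (0 < ga)%N -> (0 < ga')%N -> staircase al be al' be' i j ->
    ideal_gen (maximal_minor (herzog_matrix k al be ga al' be' ga')) p ->
  p@_(monomial3 i j 0) = 0.
Proof.
move=> ga_gt0 ga'_gt0 ij [n [r [g [gM ->]]]].
rewrite raddf_sum big1 //= => t _.
have := gM t; rewrite maximal_minor_herzog => -[]->; rewrite mulrBr mcoeffB;
  rewrite !mcoeffMX_notin ?subrr // lem_monomial3; move: ij; rewrite /staircase; lia.
Qed.

(** The relations come from the minors being in the kernel, uniqueness from the
    kernel being in the ideal: the difference of a staircase monomial and
    another monomial of the same degree would have coefficient 1 where elements of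
    the ideal have coefficient 0. *)
Lemma herzog_dataP (k : fieldType) (a b c al be ga al' be' ga' : nat) :
    [/\ 0 < a, 0 < b & 0 < c]%N -> [/\ 0 < al, 0 < be & 0 < ga]%N ->
    [/\ 0 < al', 0 < be' & 0 < ga']%N ->
    (forall p : {mpoly k[3]}, curve_morphism a b c p = 0 <->
      ideal_gen (maximal_minor (herzog_matrix k al be ga al' be' ga')) p) ->
  herzog_data a b c al be ga al' be' ga'.
Proof.
move=> abc0 up0 low0 kerE.
have minor_ker p : maximal_minor (herzog_matrix k al be ga al' be' ga') p ->
    curve_morphism a b c p = 0.
  move=> pM; apply/kerE; exists 1%N, (fun=> 1), (fun=> p); split=> //.
  by rewrite big_ord1 mul1r.
split=> //.
- have /curve_morphism_binomial : curve_morphism a b c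
    ('X_[monomial3 al 0 ga'] - 'X_[monomial3 0 (be + be') 0] : {mpoly k[3]}) = 0.
    by apply/minor_ker/maximal_minor_herzog; constructor 1.
  lia.
- have /curve_morphism_binomial : curve_morphism a b c
    ('X_[monomial3 (al + al') 0 0] - 'X_[monomial3 0 be' ga] : {mpoly k[3]}) = 0.
    by apply/minor_ker/maximal_minor_herzog; constructor 2.
  lia.
- have /curve_morphism_binomial : curve_morphism a b c
    ('X_[monomial3 al' be 0] - 'X_[monomial3 0 0 (ga + ga')] : {mpoly k[3]}) = 0.
    by apply/minor_ker/maximal_minor_herzog; constructor 3.
  lia.
move=> i j p q r ij e.
have /kerE/(mcoeff_ideal_staircase (let: And3 _ _ h := up0 in h)
    (let: And3 _ _ h := low0 in h) ij) : curve_morphism a b c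
    ('X_[monomial3 i j 0] - 'X_[monomial3 p q r] : {mpoly k[3]}) = 0.
  by apply/curve_morphism_binomial; lia.
rewrite mcoeffB !mcoeffX eqxx.
case: (monomial3 p q r =P _) => [/monomial3_inj [-> -> ->] // | _].
by rewrite subr0 => /eqP; rewrite oner_eq0.
Qed.

Lemma gen_semigroup3 (a b c x : nat) :
  gen_semigroup [:: a; b; c] x <-> exists p q r : nat, x = (p * a + q * b + r * c)%N.
Proof.
split=> [[m ->] | [p [q [r ->]]]].
  rewrite !big_ord_recl big_ord0 /= addn0 addnA.
  by exists (m ord0), (m (lift ord0 ord0)), (m (lift ord0 (lift ord0 ord0))).
exists (fun t : 'I_3 => nth 0%N [:: p; q; r] t).
by rewrite !big_ord_recl big_ord0 /= addn0 addnA.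
Qed.

Theorem corollary3p3 (a b c : nat)
    (a_gt0 : (0 < a)%N) (b_gt0 : (0 < b)%N) (c_gt0 : (0 < c)%N)
    (numH : numerical_semigroup (gen_semigroup [:: a; b; c]))
    (nsymH : ~ symmetric_semigroup (gen_semigroup [:: a; b; c]))
    (k : fieldType)
    (al be ga al' be' ga' : nat)
    (al_gt0 : (0 < al)%N) (be_gt0 : (0 < be)%N) (ga_gt0 : (0 < ga)%N)
    (al'_gt0 : (0 < al')%N) (be'_gt0 : (0 < be')%N) (ga'_gt0 : (0 < ga')%N)
    (kerE : forall p : {mpoly k[3]},
        curve_morphism a b c p = 0%R <->
        ideal_gen (maximal_minor (herzog_matrix k al be ga al' be' ga')) p) :
  pseudo_symmetric_semigroup (gen_semigroup [:: a; b; c]) <->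
  ((al * a < be' * b)%N -> [/\ al = 1%N, be = 1%N & ga = 1%N]) /\
  ((be' * b < al * a)%N -> [/\ al' = 1%N, be' = 1%N & ga' = 1%N]).
Proof.
have D : herzog_data a b c al be ga al' be' ga' by apply: herzog_dataP kerE.
have HE := gen_semigroup3 a b c.
have HE' x : gen_semigroup [:: a; b; c] x <->
    exists p q r : nat, x = (p * b + q * a + r * c)%N.
  by rewrite HE; split=> -[p [q [r ->]]]; exists q, p, r; rewrite (addnC (q * _)).
have [lt_ab|lt_ba|/(exponents_neq D HE) //] := ltngtP (al * a) (be' * b).
  rewrite (pseudo_symmetric_upper D HE numH lt_ab).
  by split=> [//|[ones _]]; exact: ones.
rewrite (pseudo_symmetric_upper (herzog_data_swap D) HE' numH lt_ba).
split=> [[-> -> ->] | [_ ones]]; first by split.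
by have [-> -> ->] := ones isT.
Qed.
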